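(* Let $m,n\in\mathbb{Z}_{>0}$, $E_1=\{1,\dots,m\}$, $E_2=\{m+1,\dots,m+n\}$, $\alpha\in\mathbb{Z}_{\ge0}^m$, $\beta\in\mathbb{Z}_{\ge0}^n$. Let $(\mathscr{C},(\alpha,\beta))$ be a caged polymatroid on $E_1\cup E_2$, and let $P$ be a polymatroid on $E_1$ with cage $\alpha$. Then polymatroid correspondence is consistent with multisymmetric lift: $$\widetilde{\mathscr{C}_*(P)}\cong\widetilde{\mathscr{C}}_*(\widetilde{P}),$$ where $\widetilde{\mathscr{C}_*(P)}$, $\widetilde{\mathscr{C}}$, $\widetilde{P}$ are the multisymmetric lifts of $(\mathscr{C}_*(P),\beta)$, $(\mathscr{C},(\alpha,\beta))$, $(P,\alpha)$, respectively, $\mathscr{C}_*$ is the polymatroid correspondence induced by $\mathscr{C}$, and $\widetilde{\mathscr{C}}_*$ is the matroid correspondence induced by $\widetilde{\mathscr{C}}$.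
   Context: A polymatroid $P$ on a finite set $E$ is given by a rank function $\mathrm{rk}:2^E\to\mathbb{Z}_{\ge0}$ that is normalized ($\mathrm{rk}(\emptyset)=0$), increasing and submodular. Its set of bases $\mathcal{B}_P$ consists of the $\beta\in\mathbb{Z}_{\ge0}^E$ with $\sum_{i\in E}\beta_i=\mathrm{rk}(E)$ and $\sum_{i\in A}\beta_i\le\mathrm{rk}(A)$ for all $A\subsetneq E$; $P$ is determined by $\mathcal{B}_P$, and the sets $\mathcal{B}_P$ are exactly the M-convex sets (nonempty subsets of some $\{\gamma\in\mathbb{Z}_{\ge0}^E:\sum\gamma_i=r\}$ satisfying: for all $u,v$ in the set and $i$ with $u_i<v_i$ there is $j$ with $u_j>v_j$ such that $u-e_j+e_i$ and $v-e_i+e_j$ are in the set). A cage for $P$ is $\alpha\in\mathbb{Z}_{\ge0}^E$ with $\mathrm{rk}(\{i\})\le\alpha_i$ for all $i$; $(P,\alpha)$ is then a caged polymatroid. Deletion $P\setminus D$ is restriction of the rank function to subsets of $E\setminus D$ (with restricted cage); the direct sum has rank function the sum of the rank functions (with concatenated cage). $\mathbf{B}_\beta$ is the Boolean polymatroid with cage $\beta$: $\mathrm{rk}(S)=\sum_{i\in S}\beta_i$. Polymatroid intersection: for two polymatroids $P,Q$ with the same cage $\alpha$, $P\wedge_\alpha Q$ is the polymatroid (with cage $\alpha$) whose bases are the componentwise-minimal elements of $\{\beta_P\cap_\alpha\beta_Q:\beta_P\in\mathcal{B}_P,\beta_Q\in\mathcal{B}_Q\}$, where $(\beta\cap_\alpha\gamma)_i=\max\{\beta_i+\gamma_i-\alpha_i,0\}$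 (these are known to form an M-convex set). Polymatroid correspondence: for $P$ a polymatroid on $E_1$ with cage $\alpha$, $\mathscr{C}_*(P):=\big((P\oplus\mathbf{B}_\beta)\wedge_{(\alpha,\beta)}\mathscr{C}\big)\setminus E_1$, a polymatroid on $E_2$ with cage $\beta$. Multisymmetric lift: for a caged polymatroid $(P,\alpha)$ on $E$, let $\widetilde E=\bigsqcup_{i\in E}E^i$ with $|E^i|=\alpha_i$; $\widetilde P$ is the matroid on $\widetilde E$ with rank function $\mathrm{rk}_{\widetilde P}(A)=\min\{\mathrm{rk}_P(B)+|A\setminus\bigcup_{i\in B}E^i|: B\subseteq E\}$. Here the sets $E^1,\dots,E^{m+n}$ have sizes given by $(\alpha,\beta)$, $\widetilde{E_1}=E^1\sqcup\cdots\sqcup E^m$, $\widetilde{E_2}=E^{m+1}\sqcup\cdots\sqcup E^{m+n}$, and $\widetilde{\mathscr{C}}$ is a matroid on $\widetilde{E_1}\sqcup\widetilde{E_2}$. Matroid correspondence: for a matroid $\mathscr{D}$ on $F_1\sqcup F_2$ and a matroid $M$ on $F_1$, $\mathscr{D}_*(M):=\big((M\oplus\mathbf{B}_{F_2})\wedge\mathscr{D}\big)\setminus F_1$, where $\mathbf{B}_{F_2}$ is the Boolean matroid on $F_2$ (only basis $F_2$) and the matroid intersection $\wedge$ has as bases the inclusion-minimal intersections of a basis of one matroid with a basis of the other. *)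

(* Defs.v *)
From mathcomp Require Import all_boot.

Set Implicit Arguments.
Unset Strict Implicit.
Unset Printing Implicit Defensive.

(* Polymatroids on a finite type E are handled through their rank functions
   {set E} -> nat; a vector of Z_{>=0}^E is a {ffun E -> nat}. *)
Section Polymatroid.
Variable E : finType.
Implicit Types (r : {set E} -> nat) (b c : {ffun E -> nat}) (cage : E -> nat).

Definition is_polymatroid r : Prop :=
  [/\ r set0 = 0,
      forall A B : {set E}, A \subset B -> r A <= r B
    & forall A B : {set E}, r (A :|: B) + r (A :&: B) <= r A + r B].

Definition is_cage r cage : Prop := forall i, r [set i] <= cage i.

Definition caged_polymatroid r cage : Prop := is_polymatroid r /\ is_cage r cage.

Definition is_basis r b : bool :=
  (\sum_i b i == r setT) &&
  [forall (A : {set E} | A \proper setT), \sum_(i in A) b i <= r A].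

(* The coordinates of a basis add up to r setT, so the bases can be enumerated
   among the vectors bounded by r setT; see mem_bases. *)
Definition bases r : seq {ffun E -> nat} :=
  [seq b <- [seq [ffun i => val (v i)] | v : {ffun E -> 'I_(r setT).+1}]
     | is_basis r b].

Lemma mem_bases r b : (b \in bases r) = is_basis r b.
Proof.
rewrite mem_filter andb_idr // => /andP[/eqP sumb _].
have ltb i : b i < (r setT).+1 by rewrite ltnS -sumb (bigD1 i) //= leq_addr.
apply/imageP; exists [ffun i => Ordinal (ltb i)] => //.
by apply/ffunP => i; rewrite !ffunE.
Qed.

(* A polymatroid is recovered from its set of bases by
   rk A = max {\sum_(i in A) b i : b a basis}; rank_of_bases s is meant for
   families s that are M-convex, as the minimal vectors in poly_meet are. *)
Definition rank_of_bases (s : seq {ffun E -> nat}) : {set E} -> nat :=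
  fun A => \max_(b <- s) \sum_(i in A) b i.

(* Truncated subtraction on nat is max (_, 0). *)
Definition cap cage b c : {ffun E -> nat} :=
  [ffun i => b i + c i - cage i].

Definition lev b c : bool := [forall i, b i <= c i].

Definition minimal_vectors (s : seq {ffun E -> nat}) : seq {ffun E -> nat} :=
  [seq x <- s | all (fun y => lev y x ==> (y == x)) s].

Definition poly_meet cage r r' : {set E} -> nat :=
  rank_of_bases (minimal_vectors
    [seq cap cage b c | b <- bases r, c <- bases r']).

Definition boolean_poly cage : {set E} -> nat := fun A => \sum_(i in A) cage i.

End Polymatroid.

(* Disjoint unions of ground sets are sum types. *)
Section Sum.
Variables E1 E2 : finType.

Definition sum_cage (alpha : E1 -> nat) (beta : E2 -> nat) (i : E1 + E2) : nat :=
  match i with inl i1 => alpha i1 | inr i2 => beta i2 end.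

Definition direct_sum (r1 : {set E1} -> nat) (r2 : {set E2} -> nat) :
    {set E1 + E2} -> nat :=
  fun A => r1 (inl @^-1: A) + r2 (inr @^-1: A).

(* Deletion of E1 from a polymatroid on the disjoint union of E1 and E2. *)
Definition delete_left (r : {set E1 + E2} -> nat) : {set E2} -> nat :=
  fun A => r (inr @: A).

Definition poly_corr (alpha : E1 -> nat) (beta : E2 -> nat)
    (C : {set E1 + E2} -> nat) (P : {set E1} -> nat) : {set E2} -> nat :=
  delete_left
    (poly_meet (sum_cage alpha beta) (direct_sum P (boolean_poly beta)) C).

End Sum.

Section Matroid.
Variable F : finType.
Implicit Types r : {set F} -> nat.

Definition is_matroid r : Prop :=
  is_polymatroid r /\ forall A : {set F}, r A <= #|A|.

Definition matroid_bases r : {set {set F}} :=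
  [set S : {set F} | (r S == #|S|) && (#|S| == r setT)].

Definition matroid_rank_of_bases (Bs : {set {set F}}) : {set F} -> nat :=
  fun A => \max_(S in Bs) #|A :&: S|.

Definition matroid_meet r r' : {set F} -> nat :=
  let caps := [set S :&: T | S in matroid_bases r, T in matroid_bases r'] in
  matroid_rank_of_bases [set X | minset [in caps] X].

Definition boolean_matroid : {set F} -> nat := fun A => #|A|.

End Matroid.

Definition matroid_corr (F1 F2 : finType) (D : {set F1 + F2} -> nat)
    (M : {set F1} -> nat) : {set F2} -> nat :=
  delete_left (matroid_meet (direct_sum M (boolean_matroid (F := F2))) D).

Definition matroid_isomorphic (F F' : finType)
    (r : {set F} -> nat) (r' : {set F'} -> nat) : Prop :=
  [/\ is_matroid r, is_matroid r'
    & exists f : F -> F', bijective f /\ forall A : {set F}, r' (f @: A) = r A].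

Section Lift.
Variables (E : finType) (cage : E -> nat).

Definition lift_ground : finType := {i : E & 'I_(cage i)}.

Definition fiber (i : E) : {set lift_ground} := [set x | tag x == i].

Definition multisym_lift (r : {set E} -> nat) : {set lift_ground} -> nat :=
  fun A =>
    let value (B : {set E}) := r B + #|A :\: \bigcup_(i in B) fiber i| in
    value [arg min_(B < set0) value B].

End Lift.

Arguments fiber {E} cage i.
Arguments multisym_lift {E} cage r A.

(* The lifted ground set over E1 + E2 is the disjoint union of the lifted ground
   sets over E1 and E2; merge_ground is the canonical bijection, and split_lift
   reads a rank function through it. *)
Section Split.
Variables (E1 E2 : finType) (alpha : E1 -> nat) (beta : E2 -> nat).

Definition merge_ground (x : lift_ground alpha + lift_ground beta) :
    lift_ground (sum_cage alpha beta) :=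
  match x with
  | inl y => existT (fun i => 'I_(sum_cage alpha beta i))
               (inl (tag y)) (tagged y)
  | inr z => existT (fun i => 'I_(sum_cage alpha beta i))
               (inr (tag z)) (tagged z)
  end.

Lemma merge_ground_bij : bijective merge_ground.
Proof.
pose g (x : lift_ground (sum_cage alpha beta)) :
    lift_ground alpha + lift_ground beta :=
  match x with
  | existT (inl i) k => inl (existT (fun i => 'I_(alpha i)) i k)
  | existT (inr j) k => inr (existT (fun j => 'I_(beta j)) j k)
  end.
by exists g; [case=> [[i k]|[j k]] | case=> [[i|j] k]].
Qed.

Definition split_lift (r : {set lift_ground (sum_cage alpha beta)} -> nat) :
    {set lift_ground alpha + lift_ground beta} -> nat :=
  fun A => r (merge_ground @: A).

End Split.

(* Main.v *)
Require Import Defs.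
From mathcomp Require Import all_boot.
From mathcomp Require Import perm zify.

(** Write [t] for the map sending a point of a lifted ground set to the index of
    its fiber.  The lift of a polymatroid [r] along [t] is the matroid of rank
    [R A = min_B (r B + #|A :\: t @^-1: B|)], so that [R (t @^-1: B) = r B] when
    the fibers have the sizes prescribed by a cage of [r].  The theorem says that
    direct sum, intersection and deletion all commute with lifting; then the two
    matroids in question have the same rank function on the same ground set, and
    the identity is an isomorphism.  Direct sums and deletion are read off the
    min-formula, and the substance is intersection, [meet_lifts].

    A set [S] is a basis of the lift of [r] exactly when the vector [mult t S]
    counting its points in each fiber is a basis of [r] ([lifts_bases]).  Two
    bases [S], [T] with fiber counts [b], [c] meet over [i] in at least
    [b i + c i - cage i] points (truncated at zero), and within the fibers they
    can be moved so that all these bounds are attained at once ([realize_cap]).  Hence a set [X] is a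
    minimal intersection of bases of the lifts iff [mult t X] is a minimal vector
    among the caps of bases of the polymatroids ([meet_bases_mult]).
    Consequently the intersection [R] of the lifts satisfies
    [R (t @^-1: B) = poly_meet cage r r' B], and [R] is unchanged by permutations
    of the ground set inside the fibers.

    It remains to see that a matroid with this symmetry is the lift of
    [B |-> R (t @^-1: B)] ([invariant_lifts]): in the closure of a set [A], the
    points of [A] whose fiber is not entirely contained in that closure are, by
    symmetry, coloops.  This needs [R] to be a matroid, that is, the minimal
    intersections of bases of two matroids to be the bases of a matroid
    ([matroid_meet_matroid]).  That fact is dual to the matroid union theorem, and
    rests on the exchange argument of [cospanning_reduce]. *)

Set Implicit Arguments.
Unset Strict Implicit.
Unset Printing Implicit Defensive.

(** * Rank functions of matroids *)

Section MatroidRank.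
Variables (F : finType) (r : {set F} -> nat).
Hypothesis r_matroid : is_matroid r.
Implicit Types A B S T X : {set F}.

Let r0 : r set0 = 0. Proof. by case: r_matroid => -[]. Qed.
Let r_card A : r A <= #|A|. Proof. by case: r_matroid. Qed.
Let r_mono A B : A \subset B -> r A <= r B.
Proof. by case: r_matroid => -[_ + _] _; apply. Qed.
Let r_submod A B : r (A :|: B) + r (A :&: B) <= r A + r B.
Proof. by case: r_matroid => -[_ _ +] _; apply. Qed.

Lemma spanningS A B : r A = r setT -> A \subset B -> r B = r setT.
Proof. by move=> rA sAB; have := r_mono sAB; have := r_mono (subsetT B); lia. Qed.

Lemma rank_setID A B : r A <= r (A :&: B) + #|A :\: B|.
Proof.
have := r_submod (A :&: B) (A :\: B); rewrite setID.
by have := r_card (A :\: B); lia.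
Qed.

(** Submodularity lets the points of [X] be removed one at a time: removing
    others first can only increase the drop caused by [x]. *)
Lemma rank_coloops A X : X \subset A ->
  (forall x, x \in X -> r (A :\ x) < r A) -> r (A :\: X) + #|X| <= r A.
Proof.
have [n leXn] := ubnP #|X|; elim: n X leXn => // n IHn X leXn sXA coX.
have [-> | [x xX]] := set_0Vmem X; first by rewrite setD0 cards0 addn0.
have sX'X : X :\ x \subset X by apply: subD1set.
have cX : #|X| = (#|X :\ x|).+1 by rewrite (cardsD1 x) xX.
have /IHn-/(_ (subset_trans sX'X sXA)) : #|X :\ x| < n by lia.
move=> /(_ (fun y yX => coX y (subsetP sX'X y yX))) IH.
have xA : x \in A by apply: (subsetP sXA).
have := r_submod (A :\: (X :\ x)) (A :\ x).
have -> : A :\: (X :\ x) :|: A :\ x = A.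
  apply/setP=> y; rewrite !inE; have [->|] := eqVneq y x; rewrite ?xA //=.
  by case: (y \in A); rewrite ?andbF ?orbT.
have -> : (A :\: (X :\ x)) :&: (A :\ x) = A :\: X.
  by apply/setP=> y; rewrite !inE; have [->|] := eqVneq y x;
    rewrite ?xX ?andbF //=; case: (y \in A); rewrite ?andbF ?andbT.
by have := coX x xX; lia.
Qed.

Lemma rank_closure A X :
  (forall x, x \in X -> r (x |: A) = r A) -> r (A :|: X) = r A.
Proof.
have [n leXn] := ubnP #|X|; elim: n X leXn => // n IHn X leXn clX.
have [-> | [x xX]] := set_0Vmem X; first by rewrite setU0.
have sX'X : X :\ x \subset X by apply: subD1set.
have cX : #|X| = (#|X :\ x|).+1 by rewrite (cardsD1 x) xX.
have /IHn : #|X :\ x| < n by lia.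
move=> /(_ (fun y yX => clX y (subsetP sX'X y yX))) IH.
have := r_submod (A :|: X :\ x) (x |: A).
have -> : A :|: X :\ x :|: (x |: A) = A :|: X.
  by apply/setP=> y; rewrite !inE; have [->|] := eqVneq y x;
    rewrite ?xX ?orbT //=; case: (y \in A); rewrite ?orbT ?orbF.
have sA : A \subset (A :|: X :\ x) :&: (x |: A).
  by rewrite subsetI subsetUl subsetUr.
have := r_mono sA; have := r_mono (subsetUl A X); have := clX x xX; lia.
Qed.

(** If no point of [S :\: S'] could be dropped, all of them would be coloops of
    [S], and [S :&: S'] would have corank [#|S :\: S'|] in [S] but at most
    [#|S' :\: S|] in [S']. *)
Lemma spanning_reduce S S' : r S = r setT -> r S' = r setT -> #|S'| < #|S| ->
  exists i, [/\ i \in S, i \notin S' & r (S :\ i) = r setT].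
Proof.
move=> rS rS' ltS.
have [/exists_inP[i /setDP[iS iS'] /eqP ri] | no] :=
    boolP [exists i in S :\: S', r (S :\ i) == r setT]; first by exists i.
have co x : x \in S :\: S' -> r (S :\ x) < r S.
  move=> xS; rewrite ltn_neqAle r_mono ?subD1set // andbT rS.
  by apply: contraNneq no => rx; apply/exists_inP; exists x => //; apply/eqP.
have := rank_coloops (subsetDl S S') co; rewrite setDDr setDv set0U.
have := rank_setID S' S; rewrite setIC.
by have := cardsID S' S; have := cardsID S S'; rewrite setIC; lia.
Qed.

(** In a minimal spanning set every point is a coloop. *)
Lemma spanning_basis S : r S = r setT ->
  exists2 T, T \in matroid_bases r & T \subset S.
Proof.
move=> rS; have := @minset_exists _ [pred T | r T == r setT] S.
rewrite inE rS eqxx => /(_ isT)[T /minsetP[/eqP/= rT minT] sTS]; exists T => //.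
have co x : x \in T -> r (T :\ x) < r T.
  move=> xT; rewrite ltn_neqAle r_mono ?subD1set // andbT rT.
  apply: contraTneq xT => rx; rewrite -(minT (T :\ x)) ?inE ?eqxx ?subD1set //.
  exact/eqP.
have := rank_coloops (subxx T) co; rewrite setDv r0 => leT.
by have := r_card T; rewrite inE -rT; lia.
Qed.

End MatroidRank.

Lemma matroid_ext (F : finType) (r r' : {set F} -> nat) :
  r =1 r' -> is_matroid r -> is_matroid r'.
Proof.
move=> eqr [[r0 rm rs] rc]; split; first split.
- by rewrite -eqr.
- by move=> A B; rewrite -!eqr; apply: rm.
- by move=> A B; rewrite -!eqr; apply: rs.
- by move=> A; rewrite -eqr.
Qed.

Lemma matroid_restrict (F F' : finType) (g : F' -> F) (r : {set F} -> nat) :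
  injective g -> is_matroid r -> is_matroid (fun A => r (g @: A)).
Proof.
move=> g_inj [[r0 rm rs] rc]; split; first split=> [|A B sAB|A B].
- by rewrite imset0.
- exact/rm/imsetS.
- by rewrite imsetU (imsetI (in2W g_inj)).
by move=> A; rewrite (leq_trans (rc _)) // card_imset.
Qed.

(** * Matroids from families of bases *)

Section RankOfBases.
Variables (F : finType) (Bs : {set {set F}}).
Implicit Types A X Y : {set F}.

Lemma rank_of_bases_ge X A : X \in Bs -> #|A :&: X| <= matroid_rank_of_bases Bs A.
Proof. by move=> XB; apply: (leq_bigmax_cond (F := fun X => #|A :&: X|)). Qed.

Hypothesis Bs_n0 : Bs != set0.

Lemma rank_of_bases_ex A :
  exists2 X, X \in Bs & matroid_rank_of_bases Bs A = #|A :&: X|.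
Proof.
have Bs_gt0 : 0 < #|[in Bs]| by rewrite card_gt0.
by have [X XB eX] := eq_bigmax_cond (fun X => #|A :&: X|) Bs_gt0; exists X.
Qed.

Hypothesis Bs_card : forall X Y, X \in Bs -> Y \in Bs -> #|X| = #|Y|.
Hypothesis Bs_complete : forall X Y (J : {set F}), X \in Bs -> Y \in Bs -> J \subset X ->
  exists2 Z, Z \in Bs & (J \subset Z) && (Z \subset J :|: Y).

(** Equal cardinality and completion amount to the basis axioms.  Completing a
    largest trace on [A :&: B] inside a basis with a largest trace on [A :|: B]
    gives a single basis that is optimal for both sets, and for a single basis
    submodularity is the modularity of cardinals. *)
Lemma matroid_rank_of_bases_matroid : is_matroid (matroid_rank_of_bases Bs).
Proof.
split; first split.
- by have [X _ ->] := rank_of_bases_ex set0; rewrite set0I cards0.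
- move=> A B sAB; have [X XB ->] := rank_of_bases_ex A.
  by apply: leq_trans (rank_of_bases_ge B XB); rewrite subset_leq_card ?setSI.
- move=> A B.
  have [X XB eX] := rank_of_bases_ex (A :&: B).
  have [Y YB eY] := rank_of_bases_ex (A :|: B).
  have [Z ZB /andP[JZ ZJY]] := Bs_complete XB YB (subsetIr (A :&: B) X).
  have leI : #|A :&: B :&: X| <= #|A :&: B :&: Z|.
    by rewrite subset_leq_card // subsetI subsetIl JZ.
  have leD : #|Z :\: (A :|: B)| <= #|Y :\: (A :|: B)|.
    apply/subset_leq_card/subsetP=> x /setDP[/(subsetP ZJY)].
    by rewrite !inE; case: (x \in A); case: (x \in B); rewrite ?orbT ?orbF.
  have := cardsID (A :|: B) Z; have := cardsID (A :|: B) Y.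
  rewrite (Bs_card ZB YB) ![_ :&: (A :|: B)]setIC.
  have := rank_of_bases_ge A ZB; have := rank_of_bases_ge B ZB.
  have := cardsUI (A :&: Z) (B :&: Z).
  rewrite -setIUl setIACA setIid; lia.
- move=> A; have [X _ ->] := rank_of_bases_ex A.
  by rewrite subset_leq_card ?subsetIl.
Qed.

End RankOfBases.

(** * Intersection of two matroids *)

Section Meet.
Variables (F : finType) (r r' : {set F} -> nat).
Hypotheses (r_matroid : is_matroid r) (r'_matroid : is_matroid r').
Implicit Types S T X Y J u v : {set F}.

Definition meet_caps : {set {set F}} :=
  [set S :&: T | S in matroid_bases r, T in matroid_bases r'].

Definition meet_bases : {set {set F}} := [set X | minset [in meet_caps] X].

(** The complements of these sets are the independent sets of the union of the
    two dual matroids; equivalently ([cospanningP]) bases may be replaced by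
    spanning sets. *)
Definition cospanning u := [exists X in meet_caps, X \subset u].

Lemma cospanningP u :
  reflect (exists S T, [/\ r S = r setT, r' T = r' setT & S :&: T \subset u])
          (cospanning u).
Proof.
apply: (iffP exists_inP) => [[X /imset2P[S T]] | [S [T [rS rT sSTu]]]].
  rewrite !inE => /andP[/eqP eS /eqP <-] /andP[/eqP eT /eqP <-] -> sXu.
  by exists S, T.
have [S' S'B sS] := spanning_basis r_matroid rS.
have [T' T'B sT] := spanning_basis r'_matroid rT.
exists (S' :&: T'); first exact: imset2_f.
by apply: subset_trans sSTu; apply: setISS.
Qed.

(** The augmentation axiom of the matroid union theorem, in complementary form.
    Write [u = S :&: T] and [v = S' :&: T'] with spanning sets such that
    [S :|: T] and [S' :|: T'] are everything, so that [#|v| < #|u|] forces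
    [#|S'| < #|S|] or [#|T'| < #|T|].  In the first case drop from [S] some
    [i \notin S'].  If [i \in T], this removes [i] from [u].  Otherwise [i] is
    added to [T], and [u] is written by a pair closer to [(S', T')]. *)
Lemma cospanning_reduce u v : cospanning u -> cospanning v -> #|v| < #|u| ->
  exists i, [/\ i \in u, i \notin v & cospanning (u :\ i)].
Proof.
have norm w : cospanning w -> exists S T,
    [/\ r S = r setT, r' T = r' setT, S :&: T = w & S :|: T = setT].
  (* Both sets receive [w], and [T] also the complement of [S]: the union is
     everything and the intersection grows exactly to [w]. *)
  move=> /cospanningP[S [T [rS rT sSTw]]]; exists (S :|: w), (T :|: ~: S :|: w).
  split.
  - exact: (spanningS r_matroid rS) (subsetUl _ _).
  - by apply: (spanningS r'_matroid rT) => //; rewrite -setUA subsetUl.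
  - apply/setP=> x; have := subsetP sSTw x; rewrite !inE.
    by case: (x \in S); case: (x \in T); case: (x \in w) => //= /(_ isT).
  by apply/setP=> x; rewrite !inE; case: (x \in S); rewrite ?orbT.
move=> /norm[S [T [rS rT STu STT]]] /norm[S' [T' [rS' rT' STv STT']]] ltvu.
have [k] := ubnP (#|S :\: S'| + #|T :\: T'|).
elim: k S T rS rT STu STT => // k IHk S T rS rT STu STT lek.
have cu : #|S| + #|T| = #|F| + #|u|.
  by rewrite -STu -cardsT -STT cardsUI.
have cv : #|S'| + #|T'| = #|F| + #|v|.
  by rewrite -STv -cardsT -STT' cardsUI.
have [ltS|leS] := ltnP #|S'| #|S|.
  have [i [iS iS' ri]] := spanning_reduce r_matroid rS rS' ltS.
  have [iT | iT] := boolP (i \in T).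
    exists i; rewrite -STu -STv !inE iS iT (negPf iS'); split=> //.
    by apply/cospanningP; exists (S :\ i), T; split; rewrite // setIDAC.
  have iT' : i \in T' by move: (in_setT i); rewrite -STT' inE (negPf iS').
  apply: (IHk (S :\ i) (i |: T)) => //.
  - exact: (spanningS r'_matroid rT) (subsetUr _ _).
  - rewrite -STu; apply/setP=> x; rewrite !inE.
    by have [->|] := eqVneq x i; rewrite // (negPf iT) andbF.
  - rewrite -STT; apply/setP=> x; rewrite !inE.
    by have [->|] := eqVneq x i; rewrite // iS.
  have -> : (i |: T) :\: T' = T :\: T'.
    by apply/setP=> x; rewrite !inE; have [->|] := eqVneq x i; rewrite // iT'.
  have : S :\ i :\: S' \proper S :\: S'.
    apply/properP; split; first by rewrite setSD ?subD1set.
    by exists i; rewrite !inE ?eqxx ?andbF // iS iS'.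
  by move=> /proper_card; lia.
have ltT : #|T'| < #|T| by lia.
have [i [iT iT' ri]] := spanning_reduce r'_matroid rT rT' ltT.
have [iS | iS] := boolP (i \in S).
  exists i; rewrite -STu -STv !inE iS iT (negPf iT') andbF; split=> //.
  by apply/cospanningP; exists S, (T :\ i); split; rewrite // setIDA.
have iS' : i \in S' by move: (in_setT i); rewrite -STT' inE (negPf iT') orbF.
apply: (IHk (i |: S) (T :\ i)) => //.
- exact: (spanningS r_matroid rS) (subsetUr _ _).
- rewrite -STu; apply/setP=> x; rewrite !inE.
  by have [->|] := eqVneq x i; rewrite // (negPf iS).
- rewrite -STT; apply/setP=> x; rewrite !inE.
  by have [->|] := eqVneq x i; rewrite // iT orbT.
have -> : (i |: S) :\: S' = S :\: S'.
  by apply/setP=> x; rewrite !inE; have [->|] := eqVneq x i; rewrite // iS'.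
have : T :\ i :\: T' \proper T :\: T'.
  apply/properP; split; first by rewrite setSD ?subD1set.
  by exists i; rewrite !inE ?eqxx ?andbF // iT iT'.
by move=> /proper_card; lia.
Qed.

Lemma meet_bases_cospanning X : X \in meet_bases -> cospanning X.
Proof.
by rewrite inE => /minsetp XC; apply/exists_inP; exists X.
Qed.

Lemma meet_basis_sub u : cospanning u -> exists2 X, X \in meet_bases & X \subset u.
Proof.
move=> /exists_inP[Y YC sYu]; have [X minX sXY] := minset_exists (P := [in meet_caps]) YC.
by exists X; rewrite ?inE // (subset_trans sXY).
Qed.

Lemma meet_bases_card X Y : X \in meet_bases -> Y \in meet_bases -> #|X| = #|Y|.
Proof.
suff le Z W : Z \in meet_bases -> W \in meet_bases -> #|Z| <= #|W|.
  by move=> XB YB; apply/eqP; rewrite eqn_leq !le.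
move=> ZB WB; rewrite leqNgt; apply/negP=> ltWZ.
have [i [iZ _ coZ]] := cospanning_reduce
  (meet_bases_cospanning ZB) (meet_bases_cospanning WB) ltWZ.
have [V VB sVZ] := meet_basis_sub coZ.
move: ZB VB; rewrite !inE => /minsetP[_ minZ] /minsetp VC.
move: iZ; rewrite -(minZ V VC (subset_trans sVZ (subD1set _ _))).
by move=> /(subsetP sVZ); rewrite !inE eqxx.
Qed.

(** Among the cospanning sets between [J] and [J :|: Y] take a minimal one.  A
    point that reduces it towards [X] lies outside [X], hence outside [J], so
    minimality forbids it to be larger than [X]. *)
Lemma meet_bases_complete X Y J : X \in meet_bases -> Y \in meet_bases ->
  J \subset X -> exists2 Z, Z \in meet_bases & (J \subset Z) && (Z \subset J :|: Y).
Proof.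
move=> XB YB sJX; pose Q := [pred u | cospanning u && (J \subset u)].
have /minset_exists[Z /minsetP[/andP[coZ sJZ] minZ] sZJY] : Q (J :|: Y).
  rewrite inE subsetUl andbT.
  have /exists_inP[W WC sWY] := meet_bases_cospanning YB.
  by apply/exists_inP; exists W; rewrite // (subset_trans sWY) ?subsetUr.
have [W WB sWZ] := meet_basis_sub coZ.
suff leZ : #|Z| <= #|W|.
  have eWZ : W = Z by apply/eqP; rewrite eqEcard sWZ.
  by exists Z; rewrite ?sJZ // -eWZ.
rewrite -(meet_bases_card XB WB) leqNgt; apply/negP=> ltXZ.
have [i [iZ iX coZi]] := cospanning_reduce coZ (meet_bases_cospanning XB) ltXZ.
have QZi : Q (Z :\ i).
  by rewrite inE coZi subsetD1 sJZ; apply: contra iX => /(subsetP sJX).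
by move: iZ; rewrite -(minZ _ QZi (subD1set _ _)) !inE eqxx.
Qed.

Lemma meet_bases_n0 : meet_bases != set0.
Proof.
have : cospanning setT by apply/cospanningP; exists setT, setT; rewrite subsetT.
by move=> /meet_basis_sub[X XB _]; apply/set0Pn; exists X.
Qed.

Lemma matroid_meet_matroid : is_matroid (matroid_meet r r').
Proof.
exact: matroid_rank_of_bases_matroid meet_bases_n0 meet_bases_card
  meet_bases_complete.
Qed.

End Meet.

(** * Lifting along a map *)

(** [R] is the lift of [r] along [t].  Stating the minimum as a relation, for an
    arbitrary [t], lets the same lemmas apply to ground sets that are sums,
    parts or bijective copies of a [lift_ground]. *)
Definition lifts (F E : finType) (t : F -> E)
    (r : {set E} -> nat) (R : {set F} -> nat) : Prop :=
  (forall A B, R A <= r B + #|A :\: t @^-1: B|) /\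
  (forall A, exists B, r B + #|A :\: t @^-1: B| <= R A).

Lemma multisym_lift_lifts (E : finType) (cage : E -> nat) (r : {set E} -> nat) :
  lifts (tag : lift_ground cage -> E) r (multisym_lift cage r).
Proof.
have fiberE B : \bigcup_(i in B) fiber cage i = tag @^-1: B.
  apply/setP=> x; rewrite !inE; apply/bigcupP/idP => [[i iB] | xB].
    by rewrite inE => /eqP->.
  by exists (tag x); rewrite ?inE.
split=> [A B|A]; rewrite /multisym_lift; case: arg_minnP => // C _ minC.
  by rewrite -fiberE; apply: minC.
by exists C; rewrite -fiberE.
Qed.

Lemma lifts_eq (F E : finType) (t : F -> E) r R R' :
  lifts t r R -> lifts t r R' -> R =1 R'.
Proof.
move=> [le ge] [le' ge'] A; apply/eqP; rewrite eqn_leq.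
have [B geB] := ge A; have [B' geB'] := ge' A.
by rewrite (leq_trans (le _ _) geB') (leq_trans (le' _ _) geB).
Qed.

Lemma lifts_dom (F F' E : finType) (g : F' -> F) (t : F -> E) r R :
  injective g -> lifts t r R -> lifts (t \o g) r (fun A => R (g @: A)).
Proof.
move=> g_inj [le ge].
have cardE (A : {set F'}) (B : {set E}) : #|g @: A :\: t @^-1: B| = #|A :\: (t \o g) @^-1: B|.
  rewrite -(card_imset _ g_inj); apply: eq_card => y.
  rewrite inE; apply/andP/imsetP=> [[yB /imsetP[x xA ey]] | [x]].
    by exists x; rewrite // inE xA andbT; move: yB; rewrite ey !inE.
  by rewrite !inE => /andP[xB xA] ->; rewrite imset_f.
split=> [A B|A]; first by rewrite -cardE.
by have [B geB] := ge (g @: A); exists B; rewrite -cardE.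
Qed.

(** Deletion in the polymatroid: points of [B] outside the image of [h] lie
    under no point of [F], so dropping them from [B] keeps the counting term and
    does not increase [r B]. *)
Lemma lifts_codom (F E E' : finType) (h : E -> E') (t : F -> E) r R :
  (forall A B : {set E'}, A \subset B -> r A <= r B) ->
  lifts (h \o t) r R -> lifts t (fun B => r (h @: B)) R.
Proof.
move=> r_mono [le ge]; split=> [A B|A].
  apply: leq_trans (le A (h @: B)) _; rewrite leq_add2l subset_leq_card //.
  by apply/setDS/subsetP=> x; rewrite !inE => /(imset_f h).
have [B geB] := ge A; exists (h @^-1: B); apply: leq_trans geB.
rewrite leq_add //; last by apply: eq_leq; apply: eq_card => x; rewrite !inE.
by apply/r_mono/subsetP=> _ /imsetP[x + ->]; rewrite inE.
Qed.

Lemma cards_sum (F1 F2 : finType) (A : {set F1 + F2}) :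
  #|A| = #|inl @^-1: A| + #|inr @^-1: A|.
Proof.
have {1}<- : inl @: (inl @^-1: A) :|: inr @: (inr @^-1: A) = A.
  apply/setP=> x; rewrite inE; apply/orP/idP.
    by case=> /imsetP[y + ->]; rewrite inE.
  by case: x => x xA; [left | right]; rewrite imset_f // inE.
rewrite cardsU disjoint_setI0 ?cards0 ?subn0; last first.
  by rewrite disjoint_subset; apply/subsetP=> _ /imsetP[y _ ->];
    rewrite inE; apply/imsetP=> -[].
by rewrite !card_imset // => ? ? [].
Qed.

Lemma lifts_direct_sum (F1 F2 E1 E2 : finType) (t : F1 + F2 -> E1 + E2)
    (t1 : F1 -> E1) (t2 : F2 -> E2) r1 r2 R1 R2 :
  (forall x, t (inl x) = inl (t1 x)) -> (forall x, t (inr x) = inr (t2 x)) ->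
  lifts t1 r1 R1 -> lifts t2 r2 R2 ->
  lifts t (direct_sum r1 r2) (direct_sum R1 R2).
Proof.
move=> tl tr [le1 ge1] [le2 ge2].
have cardE (A : {set F1 + F2}) (B : {set E1 + E2}) : #|A :\: t @^-1: B| =
    #|inl @^-1: A :\: t1 @^-1: (inl @^-1: B)| +
    #|inr @^-1: A :\: t2 @^-1: (inr @^-1: B)|.
  by rewrite cards_sum; congr (_ + _); apply: eq_card => x;
    rewrite !inE ?tl ?tr.
split=> [A B|A]; rewrite /direct_sum.
  by rewrite cardE addnACA leq_add.
have [B1 geB1] := ge1 (inl @^-1: A); have [B2 geB2] := ge2 (inr @^-1: A).
pose B : {set E1 + E2} := inl @: B1 :|: inr @: B2.
have Bl : inl @^-1: B = B1.
  apply/setP=> x; rewrite !inE mem_imset; last by move=> ? ? [].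
  by rewrite [_ \in inr @: _](introF imsetP) ?orbF // => -[].
have Br : inr @^-1: B = B2.
  apply/setP=> x; rewrite !inE [_ \in inr @: _]mem_imset; last by move=> ? ? [].
  by rewrite (introF imsetP) // => -[].
by exists B; rewrite cardE Bl Br addnACA leq_add.
Qed.

Lemma sum_card_fibers (F E : finType) (t : F -> E) (B : {set E}) (X : {set F}) :
  \sum_(i in B) #|X :&: t @^-1: [set i]| = #|X :&: t @^-1: B|.
Proof.
rewrite -sum1_card (partition_big t [in B]) => [|x]; last first.
  by rewrite !inE => /andP[].
apply: eq_bigr => i iB; rewrite -sum1_card; apply: eq_bigl => x.
by rewrite !inE; have [->|] := eqVneq (t x) i; rewrite ?iB ?andbT ?andbF.
Qed.

Lemma boolean_lifts (F E : finType) (t : F -> E) (cage : E -> nat) :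
  (forall i, #|t @^-1: [set i]| = cage i) ->
  lifts t (boolean_poly cage) (@boolean_matroid F).
Proof.
move=> cageE.
have bE B : boolean_poly cage B = #|t @^-1: B|.
  rewrite -[in RHS](setTI (t @^-1: B)) -sum_card_fibers.
  by apply: eq_bigr => i _; rewrite setTI cageE.
split=> [A B|A]; rewrite /boolean_matroid.
  by rewrite bE -(cardsID (t @^-1: B) A) leq_add2r subset_leq_card ?subsetIr.
by exists set0; rewrite bE preimset0 cards0 setD0.
Qed.

Section Fibers.
Variables (F E : finType) (t : F -> E).

(** Adding the minimizers for [A] and [B], submodularity of [r] bounds the first
    terms and the counting terms are compared point by point. *)
Lemma lifts_matroid r R : is_polymatroid r -> lifts t r R -> is_matroid R.
Proof.
move=> [r0 rm rs] [le ge].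
have R_card A : R A <= #|A|.
  by have := le A set0; rewrite r0 preimset0 setD0.
split=> //; split=> [|A B sAB|A B].
- by have := R_card set0; rewrite cards0; lia.
- have [C geC] := ge B; apply: leq_trans geC; apply: leq_trans (le A C) _.
  by rewrite leq_add2l subset_leq_card // setSD.
have [C geC] := ge A; have [D geD] := ge B.
have := rs C D; have := le (A :|: B) (C :|: D); have := le (A :&: B) (C :&: D).
suff : #|(A :|: B) :\: t @^-1: (C :|: D)| + #|(A :&: B) :\: t @^-1: (C :&: D)|
    <= #|A :\: t @^-1: C| + #|B :\: t @^-1: D| by lia.
rewrite -cardsUI -[X in _ <= X]cardsUI.
set U := (A :|: B) :\: _; set V := (A :&: B) :\: _.
rewrite -/U -/V; apply: leq_add; apply/subset_leq_card/subsetP=> x; rewrite !inE;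
by case: (x \in A); case: (x \in B); case: (t x \in C); case: (t x \in D).
Qed.

(** * Matroids symmetric within fibers *)

(** Take for [B] the fibers contained in the closure of [A].  A point [x] of [A]
    in another fiber shares it with some [y] outside the closure; exchanging
    them preserves the rank of [D := A :|: t @^-1: B], so by submodularity [x]
    is a coloop of [D] just as [y] is one of [y |: D].  Removing all these [x]
    leaves [t @^-1: B]. *)
Lemma invariant_lifts R : is_matroid R ->
  (forall (A : {set F}) x y, t x = t y -> x \in A -> y \notin A ->
     R (y |: A :\ x) <= R A) ->
  lifts t (fun B => R (t @^-1: B)) R.
Proof.
move=> R_matroid R_inv; have [[_ rm rs] rc] := R_matroid.
split=> [A B|A].
  apply: leq_trans (rank_setID R_matroid A (t @^-1: B)) _.
  by rewrite leq_add2r rm ?subsetIr.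
pose cl := [set x | R (x |: A) == R A].
exists [set i | t @^-1: [set i] \subset cl].
set B := [set i | _]; pose D := A :|: t @^-1: B.
have RD : R D = R A.
  apply: rank_closure => // x; rewrite !inE => /subsetP/(_ x).
  by rewrite !inE eqxx => /(_ isT)/eqP.
have DA : D :\: t @^-1: B = A :\: t @^-1: B by rewrite setDUl setDv setU0.
have DB : D :\: (A :\: t @^-1: B) = t @^-1: B.
  by apply/setP=> x; rewrite /D 2!in_setD in_setU; case: (x \in A); case: (x \in t @^-1: B).
rewrite -RD -[X in R X]DB; apply: rank_coloops => // [|x].
  by rewrite -DA subsetDl.
move=> /setDP[xA]; rewrite !inE => /subsetPn[y]; rewrite !inE => /eqP txy Ry.
have {}Ry : R A < R (y |: D).
  apply: leq_trans (rm (y |: A) _ _); last by rewrite setUS ?subsetUl.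
  by rewrite ltn_neqAle eq_sym Ry rm ?subsetUr.
have yD : y \notin D.
  by apply: contraTN Ry => yD; rewrite -leqNgt -RD rm // subUset sub1set yD subxx.
have xD : x \in D by rewrite inE xA.
have := R_inv D x y (esym txy) xD yD; have := rs D (y |: D :\ x).
have -> : D :|: (y |: D :\ x) = y |: D.
  apply/setP=> z; rewrite in_setU !in_setU1 in_setD1.
  by case: (z \in D); rewrite ?orbT ?andbF ?orbF.
have -> : D :&: (y |: D :\ x) = D :\ x.
  apply/setP=> z; rewrite in_setI in_setU1 in_setD1.
  by have [->|] := eqVneq z y; rewrite ?(negPf yD) ?andbF //=;
    case: (z \in D); rewrite ?andbF ?andbT.
by lia.
Qed.

(** * Bases of a lift *)

Definition mult (X : {set F}) : {ffun E -> nat} :=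
  [ffun i => #|X :&: t @^-1: [set i]|].

Lemma sum_mult X (B : {set E}) : \sum_(i in B) mult X i = #|X :&: t @^-1: B|.
Proof. by rewrite -sum_card_fibers; apply: eq_bigr => i _; rewrite ffunE. Qed.

(** A maximal set below [A] whose counts are at most [b] attains [b]. *)
Lemma mult_sandwich (X A : {set F}) (b : {ffun E -> nat}) : X \subset A ->
  (forall i, mult X i <= b i) -> (forall i, b i <= mult A i) ->
  exists S : {set F}, [/\ X \subset S, S \subset A & mult S = b].
Proof.
move=> sXA leXb lebA.
pose Q := [pred S : {set F} | (S \subset A) && [forall i, mult S i <= b i]].
have /maxset_exists[S /maxsetP[/andP[sSA /forallP leS] maxS] sXS] : Q X.
  by rewrite inE sXA; apply/forallP.
exists S; split=> //; apply/ffunP=> i; apply/eqP; rewrite eqn_leq leS /=.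
rewrite leqNgt; apply/negP=> ltSb.
have /subsetPn[x] : ~~ (A :&: t @^-1: [set i] \subset S :&: t @^-1: [set i]).
  apply: contraTN ltSb => /subset_leq_card; rewrite -leqNgt.
  by move: (lebA i); rewrite !ffunE; apply: leq_trans.
rewrite !inE => /andP[xA /eqP txi]; rewrite txi eqxx andbT => xS.
have QxS : Q (x |: S).
  rewrite inE subUset sub1set xA sSA; apply/forallP=> j.
  have [->|neji] := eqVneq j i; last first.
    apply: leq_trans (leS j); rewrite !ffunE subset_leq_card //.
    apply/subsetP=> y; rewrite !inE => /andP[/orP[/eqP->|->]] //.
    by rewrite txi eq_sym (negPf neji).
  apply: leq_trans ltSb; rewrite !ffunE setIUl.
  by apply: leq_trans (leq_card_setU _ _) _; rewrite -add1n leq_add2r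
    (leq_trans (subset_leq_card (subsetIl _ _))) ?cards1.
by move: xS; rewrite -{1}(maxS _ QxS (subsetUr _ _)) setU11.
Qed.

Variable cage : E -> nat.
Hypothesis cageE : forall i, #|t @^-1: [set i]| = cage i.

Lemma multT i : mult setT i = cage i.
Proof. by rewrite ffunE setTI. Qed.

Lemma basis_sum_le r b (A : {set E}) : is_basis r b -> \sum_(i in A) b i <= r A.
Proof.
move=> /andP[/eqP sumb /forall_inP leb].
have [/leb //|] := boolP (A \proper setT); rewrite properT negbK => /eqP->.
by rewrite -sumb; apply: eq_leq; apply: eq_bigl => i; rewrite inE.
Qed.

Lemma basis_le_cage r b i : is_cage r cage -> is_basis r b -> b i <= cage i.
Proof.
move=> r_cage /basis_sum_le-/(_ [set i]); rewrite big_set1 => leb.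
exact: leq_trans leb (r_cage i).
Qed.

(** [R S = #|S|] means that [#|S :&: t @^-1: B| <= r B] for all [B], and the cage
    ensures that the lift has the same total rank as [r]. *)
Lemma lifts_bases r R (S : {set F}) : caged_polymatroid r cage -> lifts t r R ->
  (S \in matroid_bases R) = is_basis r (mult S).
Proof.
move=> [r_poly r_cage] liftR; have [[_ Rm _] Rc] := lifts_matroid r_poly liftR.
have [r0 rm rs] := r_poly; have [le ge] := liftR.
have RT : R setT = r setT.
  apply/eqP; rewrite eqn_leq; apply/andP; split.
    by have := le setT setT; rewrite preimsetT setDv cards0 addn0.
  have [B geB] := ge setT; apply: leq_trans geB.
  have leC (C : {set E}) : r C <= \sum_(i in C) cage i.
    have [n leCn] := ubnP #|C|; elim: n C leCn => // n IHn C leCn.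
    have [-> | [i iC]] := set_0Vmem C; first by rewrite r0.
    rewrite (bigD1 i) //=; move: leCn; rewrite (cardsD1 i) iC => /IHn.
    under eq_bigl do rewrite !inE andbC.
    have := rs [set i] (C :\ i); rewrite setD1K //; have := r_cage i; lia.
  have := rs B (~: B); rewrite setUCr => rsB.
  have := leC (~: B).
  have <- : #|setT :\: t @^-1: B| = \sum_(i in ~: B) cage i.
    rewrite -(eq_bigr _ (fun i _ => multT i)) sum_mult setTI.
    by apply: eq_card => x; rewrite !inE andbT.
  by lia.
have sumT : \sum_i mult S i = #|S|.
  have := sum_mult S setT; rewrite preimsetT setIT => <-.
  by apply: eq_bigl => i; rewrite inE.
rewrite inE /is_basis sumT RT andbC.
have [eqS /=|//] := eqVneq #|S| (r setT).
apply/eqP/forall_inP=> [RS A _ | leS].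
  have := le S A; rewrite RS sum_mult.
  by have := cardsID (t @^-1: A) S; lia.
apply/eqP; rewrite eqn_leq Rc /=; have [B geB] := ge S; apply: leq_trans geB.
have : \sum_(i in B) mult S i <= r B.
  by apply: basis_sum_le; rewrite /is_basis sumT eqS eqxx; apply/forall_inP.
by rewrite sum_mult; have := cardsID (t @^-1: B) S; lia.
Qed.

Lemma minimal_vector_below (s : seq {ffun E -> nat}) x : x \in s ->
  exists2 y, y \in minimal_vectors s & lev y x.
Proof.
have [n] := ubnP (\sum_i x i); elim: n x => // n IHn x lexn xs.
have [minx | /allPn[y ys]] := boolP (all (fun y => lev y x ==> (y == x)) s).
  by exists x; rewrite ?mem_filter ?minx //; apply/forallP.
rewrite negb_imply => /andP[/forallP leyx neyx].
have [| //|z zs /forallP lezy] := IHn y; last first.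
  by exists z => //; apply/forallP=> i; apply: leq_trans (lezy i) (leyx i).
rewrite ltnS in lexn; apply: leq_trans lexn.
have [lexy eqxy] := leqif_sum (fun i (_ : true) => leqif_eq (leyx i)).
rewrite ltn_neqAle lexy eqxy andbT; apply: contra neyx => /forall_inP eqi.
by apply/eqP/ffunP=> i; apply/eqP/eqi.
Qed.

(** * Intersection commutes with lifting *)

Section MeetOfLifts.
Variables (r r' : {set E} -> nat) (R R' : {set F} -> nat).
Hypotheses (r_caged : caged_polymatroid r cage).
Hypotheses (r'_caged : caged_polymatroid r' cage).
Hypotheses (liftR : lifts t r R) (liftR' : lifts t r' R').

Definition vector_caps : seq {ffun E -> nat} :=
  [seq cap cage b c | b <- bases r, c <- bases r'].

Lemma vector_capsP z :
  reflect (exists b c, [/\ is_basis r b, is_basis r' c & z = cap cage b c])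
          (z \in vector_caps).
Proof.
apply: (iffP allpairsP) => [[[b c] /=] | [b [c [bB cB ->]]]].
  by rewrite !mem_bases => -[bB cB ->]; exists b, c.
by exists (b, c); rewrite !mem_bases.
Qed.

(** Inclusion-exclusion in each fiber. *)
Lemma cap_mult_le (S T : {set F}) : lev (cap cage (mult S) (mult T)) (mult (S :&: T)).
Proof.
apply/forallP=> i; rewrite !ffunE -cageE leq_subLR -cardsUI addnC setIACA setIid.
by rewrite addnC leq_add2r subset_leq_card // subUset !subsetIr.
Qed.

(** Extend [X] to [S] with counts [b], then extend [X] to [T] with counts [c]
    using only points outside [S].  The fibers leave enough room for the latter
    because [cap cage b c i >= b i + c i - cage i]. *)
Lemma realize_cap (X : {set F}) b c : is_basis r b -> is_basis r' c ->
  mult X = cap cage b c -> X \in meet_caps R R'.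
Proof.
move=> bB cB eX.
have [r_cage r'_cage] : is_cage r cage /\ is_cage r' cage.
  by case: r_caged r'_caged => _ + [].
have leb i := basis_le_cage i r_cage bB; have lec i := basis_le_cage i r'_cage cB.
have eXi i : mult X i = b i + c i - cage i by rewrite eX ffunE.
have [S [sXS _ eS]] : exists S : {set F}, [/\ X \subset S, S \subset setT & mult S = b].
  apply: mult_sandwich => [|i|i]; rewrite ?subsetT ?multT // eXi.
  by have := lec i; lia.
(* [X :|: ~: S] has [mult X i + (cage i - b i) >= c i] points over [i]. *)
have [T [sXT sTS eT]] :
    exists T : {set F}, [/\ X \subset T, T \subset X :|: ~: S & mult T = c].
  apply: mult_sandwich => [|i|i]; first exact: subsetUl.
    by rewrite eXi; have := leb i; lia.
  have -> : mult (X :|: ~: S) i = mult X i + (cage i - mult S i).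
    rewrite !ffunE setIUl cardsU -cageE.
    have -> : X :&: t @^-1: [set i] :&: (~: S :&: t @^-1: [set i]) = set0.
      rewrite setIACA; have -> : X :&: ~: S = set0; last by rewrite set0I.
      by apply/eqP; rewrite setI_eq0 disjoints_subset setCK.
    have := cardsID S (t @^-1: [set i]).
    by rewrite cards0 subn0 setDE [S :&: _]setIC [~: S :&: _]setIC; lia.
  by rewrite eXi eS; have := leb i; lia.
have -> : X = S :&: T.
  apply/eqP; rewrite eqEsubset subsetI sXS sXT; apply/subsetP=> x.
  by case/setIP=> xS /(subsetP sTS); rewrite !inE xS orbF.
by apply: imset2_f; rewrite (lifts_bases _ r_caged liftR, lifts_bases _ r'_caged liftR') ?eS ?eT.
Qed.

Lemma meet_capsP (X : {set F}) : X \in meet_caps R R' ->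
  exists2 z, z \in vector_caps & lev z (mult X).
Proof.
move=> /imset2P[S T]; rewrite (lifts_bases _ r_caged liftR).
rewrite (lifts_bases _ r'_caged liftR') => SB TB ->.
exists (cap cage (mult S) (mult T)); last exact: cap_mult_le.
by apply/vector_capsP; exists (mult S), (mult T).
Qed.

(** From left to right, a minimal [X] contains some set whose counts form a
    minimal cap vector, and that set is itself an intersection of bases.  From
    right to left, an intersection of bases inside [X] has counts that dominate
    a cap vector and are dominated by the minimal vector [mult X]. *)
Lemma meet_bases_mult (X : {set F}) :
  (X \in meet_bases R R') = (mult X \in minimal_vectors vector_caps).
Proof.
rewrite inE; apply/minsetP/idP => [[/meet_capsP[w ws lew] minX] | ].
  have [z zmin lezw] := minimal_vector_below ws.
  have [X' [_ sX'X eX']] : exists X' : {set F}, [/\ set0 \subset X', X' \subset X & mult X' = z].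
    apply: mult_sandwich => [|i|i]; rewrite ?sub0set //.
      by rewrite ffunE set0I cards0.
    exact: leq_trans (forallP lezw i) (forallP lew i).
  suff <- : X' = X by rewrite eX'.
  apply: minX => //; move: (zmin); rewrite mem_filter => /andP[_].
  by case/vector_capsP=> b [c [bB cB ez]]; apply: realize_cap bB cB _; rewrite eX'.
rewrite mem_filter => /andP[/allP minX /vector_capsP[b [c [bB cB eX]]]].
split=> [|Y /meet_capsP[w ws lew] sYX]; first exact: realize_cap bB cB eX.
have leYX i : mult Y i <= mult X i.
  by rewrite !ffunE subset_leq_card // setSI.
have /eqP ew : w == mult X.
  apply: (implyP (minX w ws)); apply/forallP=> i.
  exact: leq_trans (forallP lew i) (leYX i).
apply/eqP; rewrite eqEcard sYX.
have cardE (Z : {set F}) : #|Z| = \sum_(i in [set: E]) mult Z i.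
  by rewrite sum_mult preimsetT setIT.
by rewrite !cardE leq_sum // => i _; rewrite -ew (forallP lew).
Qed.

Lemma matroid_meet_preim (B : {set E}) :
  matroid_meet R R' (t @^-1: B) = poly_meet cage r r' B.
Proof.
apply/eqP; rewrite eqn_leq; apply/andP; split.
  apply/bigmax_leqP=> X; rewrite -[_ \in _]/(X \in meet_bases R R').
  rewrite meet_bases_mult setIC -sum_mult => XB.
  exact: (leq_bigmax_seq (F := fun z : {ffun E -> nat} => \sum_(i in B) z i)).
apply/bigmax_leqP_seq=> z zmin _.
have [X [_ _ eX]] : exists X : {set F}, [/\ set0 \subset X, X \subset setT & mult X = z].
  apply: mult_sandwich => [|i|i]; rewrite ?sub0set //.
    by rewrite ffunE set0I cards0.
  move: zmin; rewrite mem_filter multT => /andP[_ /vector_capsP[b [c [bB cB ->]]]].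
  rewrite ffunE; have [_ r_cage] := r_caged; have [_ r'_cage] := r'_caged.
  by have := basis_le_cage i r_cage bB; have := basis_le_cage i r'_cage cB; lia.
rewrite -eX sum_mult setIC; apply: rank_of_bases_ge.
by rewrite -/(meet_caps R R') -/(meet_bases R R') meet_bases_mult eX.
Qed.

Lemma meet_lifts_matroid : is_matroid (matroid_meet R R').
Proof.
apply: matroid_meet_matroid; first exact: lifts_matroid r_caged.1 liftR.
exact: lifts_matroid r'_caged.1 liftR'.
Qed.

Lemma mult_perm (s : {perm F}) (X : {set F}) :
  (forall x, t (s x) = t x) -> mult (s @^-1: X) = mult X.
Proof.
move=> ts; apply/ffunP=> i; rewrite !ffunE -[RHS](card_imset _ (@perm_inj _ s^-1)).
apply: eq_card => x; rewrite !inE; apply/andP/imsetP=> [[xX txi] | [y]].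
  by exists (s x); rewrite ?permK // !inE xX ts.
by rewrite !inE => /andP[yX tyi] ->; rewrite permKV -ts permKV.
Qed.

(** By [meet_bases_mult] membership in [meet_bases] depends only on the counts,
    so transposing two points of a fiber permutes the bases and
    [invariant_lifts] applies. *)
Lemma meet_lifts : lifts t (poly_meet cage r r') (matroid_meet R R').
Proof.
have [le ge] : lifts t (fun B => matroid_meet R R' (t @^-1: B)) (matroid_meet R R').
  apply: invariant_lifts meet_lifts_matroid _ => A x y txy xA yA.
  apply/bigmax_leqP=> X; rewrite -[_ \in _]/(X \in meet_bases R R') => XB.
  pose s := tperm x y.
  have ts z : t (s z) = t z by rewrite /s; case: tpermP => // ->.
  have XB' : s @^-1: X \in meet_bases R R'.
    by rewrite meet_bases_mult mult_perm // -meet_bases_mult.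
  apply: leq_trans (rank_of_bases_ge A XB').
  rewrite -(card_imset _ (@perm_inj _ s)); apply/subset_leq_card/subsetP=> z'.
  move=> /imsetP[z]; rewrite in_setI in_setU1 in_setD1 => /andP[zA zX] ->.
  rewrite !inE tpermK zX andbT /s.
  case: tpermP zA => [->|//|/eqP/negPf-> /eqP/negPf-> //].
  by rewrite eqxx orbF => /eqP exy; rewrite -exy xA in yA.
split=> [A B|A]; first by rewrite -matroid_meet_preim.
by have [B geB] := ge A; exists B; rewrite -matroid_meet_preim.
Qed.

End MeetOfLifts.
End Fibers.

(** * Compatibility with correspondences *)

Lemma poly_meet_mono (E : finType) (cage : E -> nat) r r' (A B : {set E}) :
  A \subset B -> poly_meet cage r r' A <= poly_meet cage r r' B.
Proof.
move=> sAB; apply/bigmax_leqP_seq=> z zmin _.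
apply: leq_trans (leq_bigmax_seq (F := fun z : {ffun E -> nat} =>
  \sum_(i in B) z i) _ zmin isT).
by rewrite [leqRHS](big_setID A) (setIidPr sAB) leq_addr.
Qed.

Lemma boolean_polymatroid (E : finType) (cage : E -> nat) :
  is_polymatroid (boolean_poly cage).
Proof.
split=> [|A B sAB|A B]; rewrite /boolean_poly.
- by rewrite big_set0.
- by rewrite [leqRHS](big_setID A) (setIidPr sAB) leq_addr.
rewrite [X in X + _](big_setID A) setUK [X in _ <= _ + X](big_setID A) /=.
by rewrite setDUl setDv set0U setIC addnAC addnA.
Qed.

Lemma direct_sum_caged (E1 E2 : finType) (r1 : {set E1} -> nat)
    (r2 : {set E2} -> nat) c1 c2 :
  caged_polymatroid r1 c1 -> caged_polymatroid r2 c2 ->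
  caged_polymatroid (direct_sum r1 r2) (sum_cage c1 c2).
Proof.
move=> [[r10 r1m r1s] r1c] [[r20 r2m r2s] r2c]; rewrite /direct_sum.
split; first split=> [|A B sAB|A B].
- by rewrite !preimset0 r10 r20.
- by rewrite leq_add ?r1m ?r2m ?preimsetS.
- by rewrite !preimsetU !preimsetI addnACA [leqRHS]addnACA leq_add.
have pre (T1 T2 : finType) (h : T1 -> T2) x (B : {set T1}) :
    (forall y, h y = x -> y \in B) -> h @^-1: [set x] \subset B.
  by move=> hB; apply/subsetP=> y; rewrite !inE => /eqP/hB.
move=> [i|i] /=.
- rewrite -[leqRHS]addn0 leq_add // -?r20.
    by apply: leq_trans (r1m _ _ _) (r1c i); apply: pre => y [->]; rewrite inE.
  by apply/r2m/pre.
- rewrite -[leqRHS]add0n leq_add // -?r10.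
    by apply/r1m/pre.
  by apply: leq_trans (r2m _ _ _) (r2c i); apply: pre => y [->]; rewrite inE.
Qed.

Lemma boolean_caged (E : finType) (cage : E -> nat) :
  caged_polymatroid (boolean_poly cage) cage.
Proof.
by split=> [|i]; [apply: boolean_polymatroid | rewrite /boolean_poly big_set1].
Qed.

Lemma card_fiber (E : finType) (cage : E -> nat) i :
  #|(tag : lift_ground cage -> E) @^-1: [set i]| = cage i.
Proof.
rewrite -[RHS]card_ord -cardsT.
rewrite -(card_imset _ (@eq_from_Tagged _ (fun i => 'I_(cage i)) i)).
apply: eq_card => -[j k]; rewrite !inE /=; apply/eqP/imsetP=> [eji | [k' _]].
  by subst j; exists k.
by move=> /(congr1 tag).
Qed.

Theorem proposition6p2 (m n : nat) (m_gt0 : 0 < m) (n_gt0 : 0 < n)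
    (alpha : 'I_m -> nat) (beta : 'I_n -> nat)
    (C : {set 'I_m + 'I_n} -> nat) (P : {set 'I_m} -> nat)
    (C_caged : caged_polymatroid C (sum_cage alpha beta))
    (P_caged : caged_polymatroid P alpha) :
  matroid_isomorphic
    (multisym_lift beta (poly_corr alpha beta C P))
    (matroid_corr
       (split_lift (multisym_lift (sum_cage alpha beta) C))
       (multisym_lift alpha P)).
Proof.
pose cage := sum_cage alpha beta.
pose merge := @merge_ground _ _ alpha beta.
(* [merge] identifies the two ground sets, so [t] is the fiber map of both. *)
pose t := (tag : lift_ground cage -> _) \o merge.
have [merge' mergeK mergeVK] := merge_ground_bij alpha beta.
have merge_inj : injective merge := can_inj mergeK.
have liftC : lifts t C (split_lift (multisym_lift cage C)).
  exact: lifts_dom merge_inj (multisym_lift_lifts cage C).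
have liftP : lifts t (direct_sum P (boolean_poly beta))
    (direct_sum (multisym_lift alpha P) (@boolean_matroid (lift_ground beta))).
  exact: (lifts_direct_sum (fun=> erefl) (fun=> erefl) (multisym_lift_lifts alpha P)
    (boolean_lifts (card_fiber beta))).
have cageE i : #|t @^-1: [set i]| = cage i.
  rewrite -(card_fiber cage) -[LHS](card_imset _ merge_inj).
  apply: eq_card => x; rewrite !inE; apply/imsetP/idP => [[y + ->]|tx].
    by rewrite !inE.
  by exists (merge' x); rewrite ?inE /t /merge /= mergeVK.
have sum_caged := direct_sum_caged P_caged (boolean_caged beta).
have R_matroid := meet_lifts_matroid sum_caged C_caged liftP liftC.
have liftR := meet_lifts cageE sum_caged C_caged liftP liftC.
pose inr_ground := @inr (lift_ground alpha) (lift_ground beta).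
have inr_inj : injective inr_ground by move=> ? ? [].
have corr_matroid := matroid_restrict inr_inj R_matroid.
have lift_corr := lifts_codom (t := tag) (h := inr)
  (@poly_meet_mono _ _ _ _) (lifts_dom inr_inj liftR).
have eq_corr := lifts_eq (multisym_lift_lifts beta _) lift_corr.
split; first by apply: matroid_ext corr_matroid => A; rewrite -eq_corr.
  exact: corr_matroid.
by exists id; split=> [|A]; [exists id | rewrite imset_id [RHS]eq_corr].
Qed.
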